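(* Let $p$ and the group sizes $d_1,\dots,d_p$ be fixed (not depending on $n$). Suppose that the following hold. (A1) The errors $\varepsilon_1,\dots,\varepsilon_n$ are independent and identically distributed, have $0$ as their $\tau$-th expectile (i.e. $\mathbb{E}[g_\tau(\varepsilon_i)]=0$), have a positive density which is continuous near $0$, and $\mathbb{E}(\varepsilon_i^4)<\infty$. (A2) There is a constant $C_0>0$ with $\max_{1\le i\le n}\|\mathbb{X}_i\|_\infty\le C_0$. (A3) There are constants $0<m_0\le M_0<\infty$ such that $m_0\le\delta_{\min}(\Upsilon_n)\le\delta_{\max}(\Upsilon_n)\le M_0$, where $\Upsilon_n=n^{-1}\sum_{i=1}^n\mathbb{X}_i\mathbb{X}_i^\top$. Suppose also that $\lambda_n\to0$, $n^{1/2}\lambda_n\to 0$ and $n^{(\gamma+1)/2}\lambda_n\to\infty$ as $n\to\infty$. Then $$\lim_{n\to\infty}\mathbb{P}\big[\widehat{\mathcal{A}}_n=\mathcal{A}\big]=1 .$$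
   Context: Model: for $i=1,\dots,n$, $Y_i=\sum_{j=1}^p\mathbf{X}_{ij}^\top\beta_j^0+\varepsilon_i=\mathbb{X}_i^\top\beta^0+\varepsilon_i$, where for each group $j\in\{1,\dots,p\}$ the deterministic design vector $\mathbf{X}_{ij}$ and the true (unknown) parameter $\beta_j^0$ lie in $\mathbb{R}^{d_j}$, $\mathbb{X}_i=(\mathbf{X}_{i1},\dots,\mathbf{X}_{ip})\in\mathbb{R}^r$, $\beta^0=(\beta_1^0,\dots,\beta_p^0)\in\mathbb{R}^r$, $r=\sum_{j=1}^p d_j$, and $\varepsilon_i$ is a random error. Any $\beta\in\mathbb{R}^r$ is written $\beta=(\beta_1,\dots,\beta_p)$ with $\beta_j\in\mathbb{R}^{d_j}$. It is assumed that $\|\beta_j^0\|_2\ne0$ for $j\le p^0$ and $\|\beta_j^0\|_2=0$ for $j>p^0$, where $p^0\le p$ is unknown. $\mathcal{A}=\{j:\|\beta_j^0\|_2\ne0\}=\{1,\dots,p^0\}$. For a fixed $\tau\in(0,1)$: $\rho_\tau(u)=u^2\,|\tau-\mathbb{1}_{u<0}|$ and $g_\tau(\varepsilon)=-2\varepsilon(\tau\mathbb{1}_{\varepsilon\ge0}+(1-\tau)\mathbb{1}_{\varepsilon<0})$. Expectile estimator: $\widetilde{\beta}_n=(\widetilde{\beta}_{n;1},\dots,\widetilde{\beta}_{n;p})=\arg\min_{\beta\in\mathbb{R}^r}\sum_{i=1}^n\rho_\tau(Y_i-\mathbb{X}_i^\top\beta)$. Adaptive group LASSO expectile estimator: $\widehat{\beta}_n=(\widehat{\beta}_{n;1},\dots,\widehat{\beta}_{n;p})=\arg\min_{\beta\in\mathbb{R}^r}\big\{n^{-1}\sum_{i=1}^n\rho_\tau(Y_i-\mathbb{X}_i^\top\beta)+\lambda_n\sum_{j=1}^p\widehat{\omega}_{n;j}\|\beta_j\|_2\big\}$,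 with weights $\widehat{\omega}_{n;j}=\|\widetilde{\beta}_{n;j}\|_2^{-\gamma}$, where $\gamma>0$ is a known constant and $(\lambda_n)$ is a sequence of positive tuning parameters. $\widehat{\mathcal{A}}_n=\{j\in\{1,\dots,p\}:\|\widehat{\beta}_{n;j}\|_2\ne0\}$. $\delta_{\min},\delta_{\max}$ denote smallest and largest eigenvalues; $\|\cdot\|_2$, $\|\cdot\|_\infty$ are the Euclidean and sup norms. The constants in the assumptions do not depend on $n$. *)

(* Defs.v *)
From HB Require Import structures.
From mathcomp Require Import all_boot all_order all_algebra finmap.
From mathcomp Require Import all_classical all_reals all_analysis.
Set Implicit Arguments.
Unset Strict Implicit.
Unset Printing Implicit Defensive.
Import Order.TTheory GRing.Theory Num.Theory.
Import numFieldNormedType.Exports.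
Local Open Scope classical_set_scope.
Local Open Scope ring_scope.

(* Vectors of R^r, r = \sum_j dg j, have type 'cV[R]_(\sum_(j < p) dg j); the
   j-th group of b is submxcol b j : 'cV[R]_(dg j).  The observations
   i = 1, ..., n are indexed by i < n, i.e. from 0. *)

Section vectors.
Context {R : realType}.

Definition dot k (u v : 'cV[R]_k) : R := (u^T *m v) 0 0.

Definition norm2 k (u : 'cV[R]_k) : R := Num.sqrt (\sum_(i < k) u i 0 ^+ 2).

Definition delta_min k (A : 'M[R]_k) : R := inf [set a | eigenvalue A a].

Definition delta_max k (A : 'M[R]_k) : R := sup [set a | eigenvalue A a].

Definition active p (dg : 'I_p -> nat) (b : 'cV[R]_(\sum_(j < p) dg j)) :
  {set 'I_p} := [set j : 'I_p | norm2 (submxcol b j) != 0]%SET.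

Definition gram r (X : nat -> 'cV[R]_r) (n : nat) : 'M[R]_r :=
  n%:R^-1 *: \sum_(i < n) X i *m (X i)^T.

End vectors.

Definition is_argmin {d} {U : porderType d} T (F : T -> U) (x : T) : Prop :=
  forall y, (F x <= F y)%O.

Section expectile.
Context {R : realType}.

Definition rho (tau u : R) : R := u ^+ 2 * `|tau - (u < 0)%R%:R|.

Definition g (tau e : R) : R :=
  - 2 * e * (tau * (0 <= e)%R%:R + (1 - tau) * (e < 0)%R%:R).

Definition loss r (tau : R) (X : nat -> 'cV[R]_r) (y : nat -> R) (n : nat)
  (b : 'cV[R]_r) : R := \sum_(i < n) rho tau (y i - dot (X i) b).

(* The inverse is that of \bar R, where 0^-1 = +oo and +oo * 0 = 0: a group
   whose expectile estimate is zero gets an infinite weight. *)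
Definition weight p (dg : 'I_p -> nat) (gamma : R)
  (bt : 'cV[R]_(\sum_(j < p) dg j)) (j : 'I_p) : \bar R :=
  (((norm2 (submxcol bt j)) `^ gamma)%:E^-1)%E.

Definition penalized_loss p (dg : 'I_p -> nat) (tau gamma lam : R)
  (X : nat -> 'cV[R]_(\sum_(j < p) dg j)) (y : nat -> R) (n : nat)
  (bt b : 'cV[R]_(\sum_(j < p) dg j)) : \bar R :=
  ((n%:R^-1 * loss tau X y n b)%:E +
   lam%:E * \sum_(j < p) weight gamma bt j * (norm2 (submxcol b j))%:E)%E.

End expectile.

Section probability.
Context {d : measure_display} {Omega : measurableType d} {R : realType}.
Variable P : probability Omega R.

Definition random_vector k (V : Omega -> 'cV[R]_k) : Prop :=
  forall i, measurable_fun [set: Omega] (fun w => V w i 0).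

Definition mutually_independent (X : nat -> {RV P >-> R}) : Prop :=
  forall (J : {fset nat}) (B : nat -> set R), (forall i, measurable (B i)) ->
    P (\bigcap_(i in [set` J]) (X i @^-1` B i)) =
    (\prod_(i <- J) P (X i @^-1` B i))%E.

Definition identically_distributed (X : nat -> {RV P >-> R}) : Prop :=
  forall i j (B : set R), measurable B ->
    distribution P (X i) B = distribution P (X j) B.

Definition is_density (X : {RV P >-> R}) (f : R -> R) : Prop :=
  measurable_fun [set: R] f /\
  forall B : set R, measurable B ->
    distribution P X B = (\int[lebesgue_measure]_(x in B) (f x)%:E)%E.

Definition error_assumption (tau : R) (eps : nat -> {RV P >-> R}) : Prop :=
  [/\ mutually_independent eps,
      identically_distributed eps,
      forall i, ('E_P[fun w => g tau (eps i w)] = 0)%E,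
      exists f : R -> R, [/\ forall i, is_density (eps i) f,
        forall x, 0 < f x &
        \forall x \near (0 : R), {for x, continuous f}] &
      forall i, ('E_P[(fun w => (eps i w : R) ^+ 4)%R] < +oo)%E].

End probability.

Definition design_bounded {R : realType} r (X : nat -> 'cV[R]_r) : Prop :=
  exists2 C0 : R, 0 < C0 &
    forall n, \big[Num.max/0]_(i < n) mx_norm (X i) <= C0.

(* The bounds are required from some n on: for n < r the matrix gram X n is
   singular, so they cannot hold for every n when r > 1. *)
Definition gram_eigenvalues_bounded {R : realType} r (X : nat -> 'cV[R]_r) :
  Prop :=
  exists m0 M0 : R, [/\ 0 < m0, m0 <= M0 &
    \forall n \near \oo, m0 <= delta_min (gram X n)
      /\ delta_min (gram X n) <= delta_max (gram X n)
      /\ delta_max (gram X n) <= M0].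

(* Main.v *)
Require Import Defs.
From mathcomp Require Import all_boot all_order all_algebra finmap.
From mathcomp Require Import all_classical all_reals all_analysis.
From mathcomp Require Import measurable_realfun ring lra.
Import Order.TTheory GRing.Theory Num.Theory.
Import numFieldNormedType.Exports.
Local Open Scope classical_set_scope.
Local Open Scope ring_scope.

(* The loss rho is strongly convex with derivative -g, so by the lower bound on
   the eigenvalues of the Gram matrix
     loss (b + h) >= loss b + <score b, h> + kappa n |h|^2,
   where score b = \sum_i g (Y_i - <X_i, b>) X_i.  The errors are independent
   and g (eps_i) is centred and square integrable, so |score beta0| <= M sqrt n
   with probability close to 1, by Chebyshev.  Everything else is deterministic
   on that event: comparing the criteria at the estimators and at beta0 gives
   |betat - beta0| and |betah - beta0| of order 1 / sqrt n, the penalty on the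
   active groups being negligible because lam sqrt n -> 0; hence active groups
   are kept.  If a null group of betah were nonzero, setting it to zero would
   gain at least lam (sqrt n)^gamma and cost only 1 / sqrt n, up to constants
   and per unit of its norm, contradicting lam n^((gamma+1)/2) -> +oo. *)

(** * Euclidean norm and groups of coordinates *)

Section euclidean.
Context {R : realType}.

Lemma dotE {k} (u v : 'cV[R]_k) : dot u v = \sum_(i < k) u i 0 * v i 0.
Proof. by rewrite /dot mxE; apply: eq_bigr => i _; rewrite mxE. Qed.

Lemma dotC {k} (u v : 'cV[R]_k) : dot u v = dot v u.
Proof. by rewrite !dotE; apply: eq_bigr => i _; rewrite mulrC. Qed.

Lemma dotDr {k} (u v w : 'cV[R]_k) : dot u (v + w) = dot u v + dot u w.
Proof. by rewrite /dot mulmxDr mxE. Qed.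

Lemma dotNr {k} (u v : 'cV[R]_k) : dot u (- v) = - dot u v.
Proof. by rewrite /dot mulmxN mxE. Qed.

Lemma dotBr {k} (u v w : 'cV[R]_k) : dot u (v - w) = dot u v - dot u w.
Proof. by rewrite dotDr dotNr. Qed.

Lemma dotZr {k} a (u v : 'cV[R]_k) : dot u (a *: v) = a * dot u v.
Proof. by rewrite /dot -scalemxAr mxE. Qed.

Lemma dotDl {k} (u v w : 'cV[R]_k) : dot (v + w) u = dot v u + dot w u.
Proof. by rewrite dotC dotDr !(dotC u). Qed.

Lemma dotZl {k} a (u v : 'cV[R]_k) : dot (a *: u) v = a * dot u v.
Proof. by rewrite dotC dotZr dotC. Qed.

Lemma dot0l {k} (v : 'cV[R]_k) : dot 0 v = 0.
Proof. by rewrite /dot trmx0 mul0mx mxE. Qed.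

Lemma dot_suml {k} {I : Type} (s : seq I) (F : I -> 'cV[R]_k) (v : 'cV[R]_k) :
  dot (\sum_(i <- s) F i) v = \sum_(i <- s) dot (F i) v.
Proof.
elim: s => [|i s IHs]; first by rewrite !big_nil dot0l.
by rewrite !big_cons dotDl IHs.
Qed.

Lemma dotvv {k} (u : 'cV[R]_k) : dot u u = \sum_(i < k) u i 0 ^+ 2.
Proof. by rewrite dotE; apply: eq_bigr => i _; rewrite expr2. Qed.

Lemma dotvv_ge0 {k} (u : 'cV[R]_k) : 0 <= dot u u.
Proof. by rewrite dotvv; apply: sumr_ge0 => i _; exact: sqr_ge0. Qed.

Lemma norm2_ge0 {k} (u : 'cV[R]_k) : 0 <= norm2 u.
Proof. exact: sqrtr_ge0. Qed.

Lemma norm2_sqr {k} (u : 'cV[R]_k) : norm2 u ^+ 2 = dot u u.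
Proof. by rewrite /norm2 -dotvv sqr_sqrtr // dotvv_ge0. Qed.

Lemma norm2_le {k} (u : 'cV[R]_k) a :
  0 <= a -> (norm2 u <= a) = (dot u u <= a ^+ 2).
Proof. by move=> a0; rewrite -norm2_sqr ler_pXn2r // nnegrE norm2_ge0. Qed.

Lemma dotvv_eq0 {k} (u : 'cV[R]_k) : (dot u u == 0) = (u == 0).
Proof.
apply/eqP/eqP => [|->]; last exact: dot0l.
rewrite dotvv => /psumr_eq0P u0; apply/colP => i; rewrite mxE.
by apply/eqP; rewrite -sqrf_eq0 u0 // => j _; exact: sqr_ge0.
Qed.

Lemma norm2_eq0 {k} (u : 'cV[R]_k) : (norm2 u == 0) = (u == 0).
Proof. by rewrite -sqrf_eq0 norm2_sqr dotvv_eq0. Qed.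

Lemma norm2_0 {k} : norm2 (0 : 'cV[R]_k) = 0.
Proof. by apply/eqP; rewrite norm2_eq0. Qed.

Lemma norm2_gt0 {k} (u : 'cV[R]_k) : (0 < norm2 u) = (u != 0).
Proof. by rewrite lt_neqAle norm2_ge0 andbT eq_sym norm2_eq0. Qed.

Lemma norm2N {k} (u : 'cV[R]_k) : norm2 (- u) = norm2 u.
Proof.
by rewrite /norm2; congr Num.sqrt; apply: eq_bigr => i _; rewrite mxE sqrrN.
Qed.

(** The squared norm of [dot u u *: v - dot u v *: u] is [dot u u] times the defect in the squared
    inequality. *)
Lemma cauchy_schwarz {k} (u v : 'cV[R]_k) : `|dot u v| <= norm2 u * norm2 v.
Proof.
have [->|u0] := eqVneq u 0; first by rewrite dot0l norm2_0 mul0r normr0.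
rewrite -(@ler_pXn2r _ 2) // ?nnegrE ?mulr_ge0 ?norm2_ge0 //.
rewrite exprMn !norm2_sqr real_normK ?num_real //.
have uu : 0 < dot u u by rewrite lt_neqAle dotvv_ge0 eq_sym dotvv_eq0 u0.
have := dotvv_ge0 (dot u u *: v - dot u v *: u).
rewrite -scaleN1r scalerA !(dotDl, dotDr, dotZl, dotZr) (dotC v u) => h.
rewrite -(@ler_pM2l _ (dot u u)) //.
by rewrite -subr_ge0; move: h; congr (_ <= _); ring.
Qed.

Lemma norm2D {k} (u v : 'cV[R]_k) : norm2 (u + v) <= norm2 u + norm2 v.
Proof.
rewrite norm2_le ?addr_ge0 ?norm2_ge0 //.
rewrite !dotDl !dotDr (dotC v u) sqrrD -!norm2_sqr.
have := le_trans (ler_norm _) (cauchy_schwarz u v); lra.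
Qed.

Lemma norm2_sum {k} {I : Type} (s : seq I) (F : I -> 'cV[R]_k) :
  norm2 (\sum_(i <- s) F i) <= \sum_(i <- s) norm2 (F i).
Proof.
elim: s => [|i s IHs]; first by rewrite !big_nil norm2_0.
by rewrite !big_cons (le_trans (norm2D _ _)) // lerD2l.
Qed.

Lemma norm2Z {k} a (u : 'cV[R]_k) : norm2 (a *: u) = `|a| * norm2 u.
Proof.
apply/eqP; rewrite -(@eqrXn2 _ 2) ?mulr_ge0 ?norm2_ge0 //.
by rewrite exprMn !norm2_sqr dotZl dotZr real_normK ?num_real // mulrA expr2.
Qed.

Lemma norm2_le_mx_norm {k} (u : 'cV[R]_k) c :
  mx_norm u <= c -> norm2 u <= Num.sqrt k%:R * c.
Proof.
move=> uc; have c0 : 0 <= c by exact: le_trans (normr_ge0 u) uc.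
rewrite norm2_le ?mulr_ge0 ?sqrtr_ge0 // exprMn sqr_sqrtr //.
rewrite dotvv mulr_natl; have -> : c ^+ 2 *+ k = \sum_(i < k) c ^+ 2.
  by rewrite sumr_const card_ord.
apply: ler_sum => i _; rewrite -real_normK ?num_real //.
rewrite ler_pXn2r ?nnegrE // (le_trans _ uc) // mx_normrE.
exact: (le_bigmax _ (fun ij : 'I_k * 'I_1 => `|u ij.1 ij.2|) (i, 0)).
Qed.

End euclidean.

Section groups.
Context {R : realType} {p : nat} {dg : 'I_p -> nat}.
Implicit Types u v : 'cV[R]_(\sum_(j < p) dg j).

Lemma dot_groups u v : dot u v = \sum_j dot (submxcol u j) (submxcol v j).
Proof.
rewrite -[u in LHS]submxcolK -[v in LHS]submxcolK /dot tr_mxcol mul_mxrow_mxcol.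
by rewrite summxE.
Qed.

Lemma norm2_group_le u (j : 'I_p) : norm2 (submxcol u j) <= norm2 u.
Proof.
rewrite norm2_le ?norm2_ge0 // norm2_sqr dot_groups (bigD1 j) //= lerDl.
by apply: sumr_ge0 => i _; exact: dotvv_ge0.
Qed.

(** The competitor against an estimate with a spurious group [j0]: all other groups, hence their
    penalties, are unchanged. *)
Definition zero_group u (j0 : 'I_p) : 'cV[R]_(\sum_(j < p) dg j) :=
  \mxcol_j (if j == j0 then 0 else submxcol u j).

Lemma submxcol_zero_group u j0 j :
  submxcol (zero_group u j0) j = if j == j0 then 0 else submxcol u j.
Proof. by rewrite mxcolK. Qed.

Lemma norm2_sub_zero_group u j0 :
  norm2 (u - zero_group u j0) = norm2 (submxcol u j0).
Proof.
apply/eqP; rewrite -(@eqrXn2 _ 2) ?norm2_ge0 // !norm2_sqr dot_groups.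
rewrite (bigD1 j0) //= submxcolB submxcol_zero_group eqxx subr0.
rewrite big1 ?addr0 // => j /negPf jj0.
by rewrite submxcolB submxcol_zero_group jj0 subrr dot0l.
Qed.

Lemma norm2_zero_group_sub u v j0 : submxcol v j0 = 0 ->
  norm2 (zero_group u j0 - v) <= norm2 (u - v).
Proof.
move=> v0; rewrite norm2_le ?norm2_ge0 // norm2_sqr !dot_groups.
apply: ler_sum => j _; rewrite !submxcolB submxcol_zero_group.
case: eqP => [->|_ //]; by rewrite v0 subr0 dot0l dotvv_ge0.
Qed.

End groups.

(** * Smallest eigenvalue and curvature of the design *)

(** For [b > 0] a small negative [t] lets the linear term win. The choice [t = - b / (q + 1)] works
    for every [q], including 0. *)
Lemma quadratic_ge0_eq0 {R : realFieldType} {b q : R} : 0 <= b -> 0 <= q ->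
  (forall t, 0 <= 2 * t * b + t ^+ 2 * q) -> b = 0.
Proof.
move=> b0 q0 /(_ (- (b / (q + 1)))).
have -> : 2 * - (b / (q + 1)) * b + (- (b / (q + 1))) ^+ 2 * q
   = - (b ^+ 2 * ((q + 2) / (q + 1) ^+ 2)) by field; lra.
rewrite oppr_ge0 pmulr_lle0; last by rewrite divr_gt0 ?exprn_gt0 //; lra.
by move=> h; apply/eqP; rewrite -sqrf_eq0 eq_le h sqr_ge0.
Qed.

Section rayleigh.
Context {R : realType} {k : nat}.

Lemma sphere_compact : compact [set u : 'rV[R]_k | dot u^T u^T = 1].
Proof.
have cont : continuous (fun u : 'rV[R]_k => dot u^T u^T).
  rewrite (_ : (fun u : 'rV[R]_k => _) = (fun u => \sum_i u 0 i * u 0 i)).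
    apply: continuous_big => [|i _ u]; first exact: add_continuous.
    by apply: continuousM; exact: coord_continuous.
  by apply/funext => v; rewrite dotE; apply: eq_bigr => i _; rewrite !mxE.
apply: bounded_closed_compact.
  exists 1; split; first exact: num_real.
  move=> M M1 u /= u1; rewrite [leLHS]mx_normrE.
  apply/bigmax_leP; split => [|[i j] _ /=]; first exact: le_trans (ltW M1).
  rewrite (ord1 i) (le_trans _ (ltW M1)) // -(@ler_pXn2r _ 2) ?nnegrE //.
  rewrite real_normK ?num_real // expr1n -u1 dotvv (bigD1 j) //= mxE lerDl.
  by apply: sumr_ge0 => l _; exact: sqr_ge0.
rewrite (_ : [set _ | _] = (fun u : 'rV[R]_k => dot u^T u^T) @^-1` [set 1]) //.
by apply: closed_comp => // u _; exact: cont.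
Qed.

(* The minimum of the Rayleigh quotient is attained by compactness of the
   sphere, and the first-order condition makes it an eigenvalue. *)
Lemma delta_min_rayleigh (A : 'M[R]_k) (u : 'cV[R]_k) : A^T = A ->
  (forall v, 0 <= dot v (A *m v)) ->
  delta_min A * dot u u <= dot u (A *m u).
Proof.
move=> Asym Apsd; have [->|u0] := eqVneq u 0.
  by rewrite !dot0l mulr0.
have normed (v : 'cV[R]_k) : v != 0 ->
    dot ((norm2 v)^-1 *: v) ((norm2 v)^-1 *: v) = 1.
  by move=> v0; rewrite dotZl dotZr -norm2_sqr; field; rewrite norm2_eq0.
have cont : continuous (fun v : 'rV[R]_k => dot v^T (A *m v^T)).
  rewrite (_ : (fun v : 'rV[R]_k => _) =
      (fun v => \sum_i v 0 i * \sum_j A i j * v 0 j)).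
    apply: continuous_big => [|i _ v]; first exact: add_continuous.
    apply: continuousM; first exact: coord_continuous.
    move: v; apply: continuous_big => [|j _ v]; first exact: add_continuous.
    by apply: continuousM; [exact: cst_continuous|exact: coord_continuous].
  apply/funext => w; rewrite dotE; apply: eq_bigr => i _; rewrite !mxE.
  by congr *%R; apply: eq_bigr => j _; rewrite !mxE.
have [||v] := compact_EVT_min _ sphere_compact (f := fun v => dot v^T (A *m v^T)).
- by exists ((norm2 u)^-1 *: u)^T; rewrite /= !trmxK normed.
- exact: continuous_subspaceT.
rewrite inE /= => v1 vmin; set a := dot v^T (A *m v^T).
(* Minimality on the sphere extends to all vectors by homogeneity. *)
have le_a w : a * dot w w <= dot w (A *m w).
  have [->|w0] := eqVneq w 0; first by rewrite !dot0l mulr0.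
  have := vmin ((norm2 w)^-1 *: w)^T.
  rewrite inE /= !trmxK normed // => /(_ erefl).
  rewrite -/a -scalemxAr dotZl dotZr mulrA -invfM -expr2 norm2_sqr.
  by rewrite mulrC ler_pdivlMr // lt_neqAle dotvv_ge0 eq_sym dotvv_eq0 w0.
have AC x y : dot x (A *m y) = dot y (A *m x).
  by rewrite {1}dotC /dot trmx_mul Asym -mulmxA.
have Av : A *m v^T = a *: v^T.
  apply/eqP; rewrite -subr_eq0 -dotvv_eq0; set w := A *m v^T - a *: v^T.
  have ww : dot w w = dot w (A *m v^T) - a * dot w v^T by rewrite dotBr dotZr.
  clearbody w; set q := dot w (A *m w) - a * dot w w.
  have q0 : 0 <= q by rewrite subr_ge0.
  (* The form [dot x (A *m x) - a * dot x x] is nonnegative and vanishes at [v^T], so its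
     first-order variation along the residual [w], which is [2 * dot w w], must be zero. *)
  have key t : 0 <= 2 * t * dot w w + t ^+ 2 * q.
    have := le_a (v^T + t *: w); rewrite -subr_ge0.
    suff -> : dot (v^T + t *: w) (A *m (v^T + t *: w)) -
      a * dot (v^T + t *: w) (v^T + t *: w) = 2 * t * dot w w + t ^+ 2 * q by [].
    rewrite mulmxDr -scalemxAr !(dotDl, dotDr, dotZl, dotZr) (AC v^T w).
    rewrite (dotC v^T w) v1 -/a /q ww; ring.
  by rewrite (quadratic_ge0_eq0 (dotvv_ge0 w) q0 key).
have : delta_min A <= a.
  (* The infimum lies below a given eigenvalue once the spectrum is bounded below; positive
     semi-definiteness gives the bound 0. Eigenvectors are rows here, hence the transpositions. *)
  apply: ge_inf.
    exists 0 => b /eigenvalueP [x xA x0].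
    have := Apsd x^T; rewrite /dot trmxK mulmxA xA -scalemxAl mxE pmulr_lge0 //.
    have := dotvv_ge0 x^T; rewrite le_eqVlt eq_sym dotvv_eq0 /dot trmxK trmx_eq0.
    by rewrite (negPf x0).
  apply/eigenvalueP; exists v.
    by apply: trmx_inj; rewrite trmx_mul Asym Av linearZ.
  apply/eqP => v0; move: v1; rewrite v0 trmx0 dot0l => /eqP.
  by rewrite eq_sym oner_eq0.
by move=> /(ler_wpM2r (dotvv_ge0 u)) /le_trans; apply.
Qed.

Lemma gram_dot (X : nat -> 'cV[R]_k) n (u : 'cV[R]_k) :
  dot u (gram X n *m u) = n%:R^-1 * \sum_(i < n) dot (X i) u ^+ 2.
Proof.
rewrite /gram -scalemxAl dotZr mulmx_suml dotC dot_suml; congr *%R.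
apply: eq_bigr => i _; rewrite -mulmxA.
rewrite (_ : (X i)^T *m u = (dot (X i) u)%:M); last first.
  by apply/matrixP => a b; rewrite !ord1 [RHS]mxE.
by rewrite mul_mx_scalar dotZl expr2.
Qed.

Lemma delta_min_gram (X : nat -> 'cV[R]_k) n (u : 'cV[R]_k) : (0 < n)%N ->
  n%:R * delta_min (gram X n) * dot u u <= \sum_(i < n) dot (X i) u ^+ 2.
Proof.
move=> n0; have n0' : 0 < n%:R :> R by rewrite ltr0n.
rewrite -mulrA -ler_pdivlMl // -gram_dot; apply: delta_min_rayleigh.
  rewrite /gram linearZ/= linear_sum/=; congr *:%R; apply: eq_bigr => i _.
  by rewrite trmx_mul trmxK.
move=> v; rewrite gram_dot mulr_ge0 ?invr_ge0 ?ler0n //.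
by apply: sumr_ge0 => i _; exact: sqr_ge0.
Qed.

End rayleigh.

(** * Expectile loss and its penalization *)

Section expectile_loss.
Context {R : realType} {tau : R} (tau0 : 0 < tau) (tau1 : tau < 1).

(** On the two half-lines [rho tau] is quadratic with coefficients [tau] and [1 - tau], both at
    least the minimum. If [u] and [u - v] have the same sign, expand exactly; otherwise [v ^+ 2]
    splits into [u ^+ 2], [(u - v) ^+ 2] and [- 2 * u * (u - v)], all nonnegative. *)
Lemma rho_strongly_convex u v :
  rho tau u + g tau u * v + Num.min tau (1 - tau) * v ^+ 2 <= rho tau (u - v).
Proof.
set m := Num.min tau (1 - tau).
have mt : 0 <= tau - m by rewrite subr_ge0 /m ge_min lexx.
have mt' : 0 <= 1 - tau - m by rewrite subr_ge0 /m ge_min lexx orbT.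
clearbody m; rewrite /rho /g.
have at0 : `|tau| = tau by rewrite ger0_norm // ltW.
have at1 : `|tau - 1| = 1 - tau by rewrite ler0_norm ?opprB ?subr_le0 ?ltW.
rewrite -subr_ge0.
case: (ltrP u 0) => u0; case: (ltrP (u - v) 0) => uv0;
  rewrite ?subr0 ?at0 ?at1 ?mulr0 ?mulr1 ?addr0 ?add0r.
- suff : 0 <= (1 - tau - m) * v ^+ 2 by congr (_ <= _); ring.
  by rewrite mulr_ge0 ?sqr_ge0.
- suff : 0 <= (tau - m) * (u - v) ^+ 2 +
    (1 - tau - m) * (u ^+ 2 + 2 * (- u * (u - v))) by congr (_ <= _); ring.
  have uv : 0 <= - u * (u - v) by rewrite mulr_ge0 // oppr_ge0 ltW.
  by rewrite addr_ge0 // mulr_ge0 ?sqr_ge0 // addr_ge0 ?sqr_ge0 // mulr_ge0.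
- suff : 0 <= (1 - tau - m) * (u - v) ^+ 2 +
    (tau - m) * (u ^+ 2 + 2 * (u * (v - u))) by congr (_ <= _); ring.
  have uv : 0 <= u * (v - u) by rewrite mulr_ge0 // -opprB oppr_ge0 ltW.
  by rewrite addr_ge0 // mulr_ge0 ?sqr_ge0 // addr_ge0 ?sqr_ge0 // mulr_ge0.
- suff : 0 <= (tau - m) * v ^+ 2 by congr (_ <= _); ring.
  by rewrite mulr_ge0 ?sqr_ge0.
Qed.

(** [g tau] is continuous and piecewise linear, with slopes [- 2 * tau] and [- 2 * (1 - tau)]. *)
Lemma g_lipschitz u v : `|g tau (u - v) - g tau u| <= 2 * `|v|.
Proof.
have [t0 t1] : 0 < tau /\ tau < 1 by [].
rewrite /g; case: (ltrP u 0) => u0; case: (ltrP (u - v) 0) => uv0;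
  rewrite ?mulr0 ?mulr1 ?addr0 ?add0r ler_norml; apply/andP;
  case: (ger0P v) => v0; split; nra.
Qed.

Lemma g_norm_le u : `|g tau u| <= 2 * `|u|.
Proof.
have := g_lipschitz 0 (- u); rewrite opprK add0r normrN.
by rewrite [X in _ - X](_ : _ = 0) ?subr0 // /g mulr0 mul0r.
Qed.

Context {r : nat} (X : nat -> 'cV[R]_r) (y : nat -> R) (n : nat).

(** The gradient of [loss] at [b]. *)
Definition score (b : 'cV[R]_r) : 'cV[R]_r :=
  \sum_(i < n) g tau (y i - dot (X i) b) *: X i.

Lemma loss_strongly_convex b h :
  loss tau X y n b + dot (score b) h +
    Num.min tau (1 - tau) * \sum_(i < n) dot (X i) h ^+ 2 <=
  loss tau X y n (b + h).
Proof.
rewrite /loss /score dot_suml mulr_sumr -!big_split/=; apply: ler_sum => i _.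
by rewrite dotZl dotDr opprD addrA; exact: rho_strongly_convex.
Qed.

(** The 2 comes from [g_lipschitz]; one factor [B] bounds the change of a residual, by
    Cauchy-Schwarz, the other the vector [X i] itself. *)
Lemma score_lipschitz B b h : (forall i, norm2 (X i) <= B) ->
  norm2 (score (b + h) - score b) <= n%:R * (2 * B ^+ 2) * norm2 h.
Proof.
move=> XB; rewrite /score -sumrB (le_trans (norm2_sum _ _)) //.
apply: (@le_trans _ _ (\sum_(i < n) 2 * B ^+ 2 * norm2 h)); last first.
  by rewrite sumr_const card_ord -[_ *+ n]mulr_natl mulrA.
apply: ler_sum => i _; rewrite -scalerBl norm2Z dotDr opprD addrA.
have B0 : 0 <= B by rewrite (le_trans (norm2_ge0 (X i))).
have := g_lipschitz (y i - dot (X i) b) (dot (X i) h).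
move=> gle; apply: (@le_trans _ _ ((2 * (B * norm2 h)) * B)); last first.
  by rewrite (_ : _ * B = 2 * B ^+ 2 * norm2 h) //; ring.
apply: ler_pM; rewrite ?norm2_ge0 //; apply: (le_trans gle); rewrite ler_pM2l //.
apply: (le_trans (cauchy_schwarz _ _)); apply: ler_wpM2r => //; exact: norm2_ge0.
Qed.

End expectile_loss.

(* The finite weights; where [weight] is infinite this one is [0^-1 = 0]. *)
Definition real_weight {R : realType} {p : nat} {dg : 'I_p -> nat} (gamma : R)
    (bt : 'cV[R]_(\sum_(j < p) dg j)) (j : 'I_p) : R :=
  (norm2 (submxcol bt j) `^ gamma)^-1.

Section penalized_loss.
Context {R : realType} {p : nat} {dg : 'I_p -> nat} {tau gamma lam : R}.
Hypotheses (gamma0 : 0 < gamma) (lam0 : 0 < lam).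
Context {X : nat -> 'cV[R]_(\sum_(j < p) dg j)} {y : nat -> R} {n : nat}.
Implicit Types b bt : 'cV[R]_(\sum_(j < p) dg j).

Lemma real_weight_ge0 bt j : 0 <= real_weight gamma bt j.
Proof. by rewrite invr_ge0 powR_ge0. Qed.

(** Where the weight is infinite the group of [b] is null, and both conventions, [+oo * 0 = 0] and
    [0^-1 = 0], give a zero penalty. *)
Lemma penalized_lossE bt b :
  (forall j, submxcol bt j = 0 -> submxcol b j = 0) ->
  penalized_loss tau gamma lam X y n bt b =
  (n%:R^-1 * loss tau X y n b +
   lam * \sum_j real_weight gamma bt j * norm2 (submxcol b j))%:E.
Proof.
move=> btb; rewrite /penalized_loss EFinD EFinM; congr (_ + _)%E.
rewrite EFinM; congr (_ * _)%E; rewrite -sumEFin; apply: eq_bigr => j _.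
rewrite /weight /real_weight inver powR_eq0 (gt_eqF gamma0) andbT norm2_eq0.
case: eqP => [/btb ->|_]; last by rewrite EFinM.
by rewrite norm2_0 mule0 mulr0.
Qed.

Lemma penalized_loss_infinite {bt b j} : submxcol bt j = 0 -> submxcol b j != 0 ->
  penalized_loss tau gamma lam X y n bt b = +oo%E.
Proof.
move=> btj bj; rewrite /penalized_loss.
suff -> : (\sum_(i < p) weight gamma bt i * (norm2 (submxcol b i))%:E = +oo)%E.
  by rewrite gt0_muley ?lte_fin // addey.
rewrite (bigD1 j) //= {1}/weight btj norm2_0 powR0 ?gt_eqF // inve0.
rewrite gt0_mulye ?lte_fin ?norm2_gt0 // addye //.
(* The other terms are nonnegative, so [+oo] meets no [-oo] in the sum. *)
rewrite gt_eqF // (@lt_le_trans _ _ 0%E) // ?ltNyr //; apply: sume_ge0 => i _.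
by rewrite mule_ge0 ?inve_ge0 ?lee_fin ?powR_ge0 ?norm2_ge0.
Qed.

(* A minimizer vanishes on the groups of infinite weight, since the penalized
   loss of 0 is finite; so it minimizes the real-valued criterion. *)
Lemma penalized_argmin {bt bh} :
  is_argmin (penalized_loss tau gamma lam X y n bt) bh ->
  (forall j, submxcol bt j = 0 -> submxcol bh j = 0) /\
  (forall b, (forall j, submxcol bt j = 0 -> submxcol b j = 0) ->
    n%:R^-1 * loss tau X y n bh +
      lam * \sum_j real_weight gamma bt j * norm2 (submxcol bh j) <=
    n%:R^-1 * loss tau X y n b +
      lam * \sum_j real_weight gamma bt j * norm2 (submxcol b j)).
Proof.
move=> bh_min.
have bh0 j : submxcol bt j = 0 -> submxcol bh j = 0.
  move=> btj; apply/eqP/negPn/negP => bhj; have := bh_min 0.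
  rewrite (penalized_loss_infinite btj bhj) penalized_lossE.
    by rewrite leye_eq.
  by move=> i _; rewrite submxcol0.
split=> // b btb; have := bh_min b.
by rewrite !penalized_lossE // lee_fin.
Qed.

End penalized_loss.

(** * Selection on the event of a small score *)

Lemma norm2_ge_sub {R : realType} {k : nat} (u v : 'cV[R]_k) :
  norm2 v - norm2 (u - v) <= norm2 u.
Proof.
rewrite lerBlDr -[X in norm2 X <= _](subKr u) (le_trans (norm2D _ _)) //.
by rewrite norm2N.
Qed.

Lemma dot_ge {R : realType} {k : nat} (u v : 'cV[R]_k) c : norm2 u <= c ->
  - (c * norm2 v) <= dot u v.
Proof.
move=> uc; rewrite lerNl (le_trans (ler_norm _)) // normrN.
by rewrite (le_trans (cauchy_schwarz _ _)) // ler_wpM2r ?norm2_ge0.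
Qed.

Lemma activeE {R : realType} {p : nat} {dg : 'I_p -> nat}
    (b : 'cV[R]_(\sum_(j < p) dg j)) j : (j \in active b) = (submxcol b j != 0).
Proof. by rewrite inE norm2_eq0. Qed.

(** Quadratic growth against a linear bound yields a rate after division by [s * D]. With [s] the
    square root of [n] the rate is of order [1 / s]. *)
Lemma le_of_quadratic_le {R : realFieldType} {kappa s c D : R} :
  0 < kappa -> 0 < s -> 0 <= c -> 0 <= D ->
  kappa * s ^+ 2 * D ^+ 2 <= c * s * D -> D <= c / (kappa * s).
Proof.
move=> kappa0 s0 c0; rewrite le_eqVlt => /orP[/eqP <- _|D0].
  by rewrite divr_ge0 ?mulr_ge0 ?(ltW kappa0) ?(ltW s0).
rewrite ler_pdivlMr ?mulr_gt0 // => le_sD.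
rewrite -(ler_pM2r (mulr_gt0 s0 D0)).
by move: le_sD; congr (_ <= _); ring.
Qed.

Section selection.
Context {R : realType} {p : nat} {dg : 'I_p -> nat} {tau gamma lam : R}.
Context {X : nat -> 'cV[R]_(\sum_(j < p) dg j)} {y : nat -> R} {n : nat}.
Context {beta0 bt bh : 'cV[R]_(\sum_(j < p) dg j)} {m0 B M a : R}.
Hypotheses (tau0 : 0 < tau) (tau1 : tau < 1) (gamma0 : 0 < gamma).
Hypotheses (lam0 : 0 < lam) (n0 : (0 < n)%N) (m0_gt0 : 0 < m0) (M0 : 0 < M).
Hypothesis design_curvature : forall h : 'cV[R]_(\sum_(j < p) dg j),
  n%:R * m0 * dot h h <= \sum_(i < n) dot (X i) h ^+ 2.
Hypothesis design_bound : forall i, norm2 (X i) <= B.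
Hypothesis score_bound : norm2 (@score R tau _ X y n beta0) <= M * Num.sqrt n%:R.
Hypothesis bt_min : is_argmin (loss tau X y n) bt.
Hypothesis bh_min : is_argmin (penalized_loss tau gamma lam X y n bt) bh.
Hypothesis a0 : 0 < a.
Hypothesis beta0_active : forall j, submxcol beta0 j != 0 ->
  a <= norm2 (submxcol beta0 j).

Let kappa := Num.min tau (1 - tau) * m0.
Let s : R := Num.sqrt n%:R.

Let kappa0 : 0 < kappa.
Proof. by rewrite mulr_gt0 // lt_min tau0 subr_gt0. Qed.

Let s0 : 0 < s.
Proof. by rewrite sqrtr_gt0 ltr0n. Qed.

Let ns : n%:R = s ^+ 2 :> R.
Proof. by rewrite sqr_sqrtr // ler0n. Qed.

(** Strong convexity at [beta0], the linear term being bounded by the score bound and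
    Cauchy-Schwarz. From here on [n] is written [s ^+ 2], so that estimates are polynomial in
    [s]. *)
Lemma loss_growth h : loss tau X y n beta0 + kappa * s ^+ 2 * norm2 h ^+ 2 -
  M * s * norm2 h <= loss tau X y n (beta0 + h).
Proof.
apply: le_trans (loss_strongly_convex tau0 tau1 X y n beta0 h).
have := dot_ge _ h _ score_bound; rewrite -/s.
have tt : 0 <= Num.min tau (1 - tau) by rewrite le_min ltW //= subr_ge0 ltW.
have := ler_wpM2l tt (design_curvature h).
by rewrite ns -norm2_sqr /kappa; lra.
Qed.

Lemma expectile_rate : norm2 (bt - beta0) <= M / (kappa * s).
Proof.
apply: le_of_quadratic_le => //; rewrite ?norm2_ge0 ?(ltW M0) //.
have := loss_growth (bt - beta0).
have := bt_min beta0; rewrite subrKC; lra.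
Qed.

Hypothesis expectile_close : M / (kappa * s) <= a / 2.

Lemma expectile_active j : submxcol beta0 j != 0 ->
  a / 2 <= norm2 (submxcol bt j).
Proof.
move=> /beta0_active aj.
have := norm2_ge_sub (submxcol bt j) (submxcol beta0 j).
have := norm2_group_le (bt - beta0) j; rewrite submxcolB.
have := expectile_rate; have := expectile_close; lra.
Qed.

(** Makes [beta0] an admissible competitor in [penalized_argmin]. *)
Lemma expectile_eq0 j : submxcol bt j = 0 -> submxcol beta0 j = 0.
Proof.
move=> btj; apply/eqP/negPn/negP => /expectile_active.
by rewrite btj norm2_0 leNgt divr_gt0.
Qed.

Lemma weight_active j : submxcol beta0 j != 0 ->
  real_weight gamma bt j <= ((a / 2) `^ gamma)^-1.
Proof.
move=> /expectile_active aj; have a2 : 0 < a / 2 by rewrite divr_gt0.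
have bj : 0 < norm2 (submxcol bt j) by exact: lt_le_trans aj.
rewrite lef_pV2 ?posrE ?powR_gt0 //.
by apply: ge0_ler_powR; rewrite ?nnegrE ?norm2_ge0 // ltW.
Qed.

(** On a null group the estimate is pure error, so [expectile_rate] bounds it and the weight grows
    at least like [s] to the power [gamma]; [weight_active] bounds the active weights by a
    constant. *)
Lemma weight_null j : submxcol beta0 j = 0 -> submxcol bt j != 0 ->
  ((M / (kappa * s)) `^ gamma)^-1 <= real_weight gamma bt j.
Proof.
move=> b0j btj.
have le_rate : norm2 (submxcol bt j) <= M / (kappa * s).
  rewrite (le_trans _ expectile_rate) // (le_trans _ (norm2_group_le _ j)) //.
  by rewrite submxcolB b0j subr0.
have bj : 0 < norm2 (submxcol bt j) by rewrite norm2_gt0.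
rewrite lef_pV2 ?posrE ?powR_gt0 ?(lt_le_trans bj) //.
by apply: ge0_ler_powR; rewrite ?nnegrE ?norm2_ge0 // ltW // (lt_le_trans bj).
Qed.

Hypothesis penalty_small : lam * s * (p%:R * ((a / 2) `^ gamma)^-1) <= 1.

(** As for [expectile_rate], by comparison with [beta0]. Multiplied by [n], the penalty difference
    is at most [s * D] by [penalty_small], which turns [M] into [M + 1]. *)
Lemma penalized_rate : norm2 (bh - beta0) <= (M + 1) / (kappa * s).
Proof.
have D0 := norm2_ge0 (bh - beta0); set D := norm2 _ in D0 *.
apply: le_of_quadratic_le => //; first by rewrite addr_ge0 // ltW.
have := loss_growth (bh - beta0); rewrite -/D subrKC.
have [_ /(_ beta0 expectile_eq0)] := penalized_argmin gamma0 lam0 bh_min.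
have Omega0 : 0 <= ((a / 2) `^ gamma)^-1 by rewrite invr_ge0 powR_ge0.
have small := penalty_small.
set Omega := ((a / 2) `^ gamma)^-1 in small Omega0 *.
(* Null groups of [beta0] contribute at most 0; on active ones the triangle inequality and
   [weight_active] apply. *)
have penalty_diff :
    \sum_j real_weight gamma bt j * norm2 (submxcol beta0 j) -
    \sum_j real_weight gamma bt j * norm2 (submxcol bh j) <= p%:R * Omega * D.
  rewrite -sumrB (@le_trans _ _ (\sum_(j < p) Omega * D)) //; last first.
    by rewrite sumr_const card_ord -[_ *+ p]mulr_natl mulrA.
  apply: ler_sum => j _; rewrite -mulrBr.
  have [b0j|b0j] := eqVneq (submxcol beta0 j) 0.
    rewrite b0j norm2_0 sub0r (@le_trans _ _ 0) ?mulr_ge0 //.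
    by rewrite mulr_ge0_le0 ?real_weight_ge0 // oppr_le0 norm2_ge0.
  have bj : norm2 (submxcol beta0 j) - norm2 (submxcol bh j) <= D.
    rewrite lerBlDr -lerBlDl (le_trans _ (norm2_ge_sub _ (submxcol beta0 j))) //.
    by rewrite lerD2l lerN2 -submxcolB norm2_group_le.
  apply: (le_trans (ler_wpM2l (real_weight_ge0 _ _) bj)).
  by apply: ler_wpM2r => //; exact: weight_active.
rewrite ns; set S0 := \sum_j _ in penalty_diff *.
set Sh := \sum_j _ in penalty_diff *.
move: penalty_diff small D0 s0 lam0.
set Lh := loss _ _ _ _ _; set L0 := loss _ _ _ _ _.
move: S0 Sh L0 Lh D Omega Omega0 (s) (lam) (kappa).
move=> S0 Sh L0 Lh D O O0 t l k Sle tle D0 t0 l0 q_le growth.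
have : Lh - L0 <= t ^+ 2 * (l * (S0 - Sh)).
  rewrite -ler_pdivrMl ?exprn_gt0 // -subr_ge0.
  by move: q_le; rewrite -subr_ge0; congr (_ <= _); ring.
have : t ^+ 2 * (l * (S0 - Sh)) <= t * D.
  apply: (@le_trans _ _ (t ^+ 2 * (l * (p%:R * O * D)))).
    by rewrite ler_pM2l ?exprn_gt0 // ler_pM2l.
  have -> : t ^+ 2 * (l * (p%:R * O * D)) = l * t * (p%:R * O) * (t * D) by ring.
  by rewrite ler_piMl // mulr_ge0 // ltW.
lra.
Qed.

Hypothesis penalized_close : (M + 1) / (kappa * s) < a.

(** Losing an active group would put [bh] at distance at least [a] from [beta0]. *)
Lemma active_kept j : submxcol beta0 j != 0 -> submxcol bh j != 0.
Proof.
move=> /beta0_active aj; apply/eqP => bhj.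
have := norm2_group_le (bh - beta0) j; rewrite submxcolB bhj sub0r norm2N.
move=> /(le_trans aj) /le_trans /(_ penalized_rate).
by rewrite leNgt penalized_close.
Qed.

Hypothesis penalty_large : M + 2 * B ^+ 2 * ((M + 1) / kappa) <
  lam * s * ((M / (kappa * s)) `^ gamma)^-1.

(* Setting a spurious group of [bh] to zero gains [lam] times its weight and
   costs at most the norm of the score over [n], both per unit of its norm. *)
Lemma null_dropped j : submxcol beta0 j = 0 -> submxcol bh j = 0.
Proof.
move=> b0j; apply/eqP/negPn/negP => bhj.
have [bh_null bh_le] := penalized_argmin gamma0 lam0 bh_min.
have btj : submxcol bt j != 0 by apply: contra bhj => /eqP /bh_null ->.
pose b' := zero_group bh j.
have b'E i : submxcol b' i = if i == j then 0 else submxcol bh i.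
  exact: submxcol_zero_group.
have /bh_le : forall i, submxcol bt i = 0 -> submxcol b' i = 0.
  by move=> i /bh_null bhi; rewrite b'E bhi if_same.
have -> : \sum_i real_weight gamma bt i * norm2 (submxcol bh i) =
    real_weight gamma bt j * norm2 (submxcol bh j) +
    \sum_i real_weight gamma bt i * norm2 (submxcol b' i).
  rewrite (bigD1 j) //= [in RHS](bigD1 j) //= b'E eqxx norm2_0 mulr0 add0r.
  by congr +%R; apply: eq_bigr => i /negPf ij; rewrite b'E ij.
set S := \sum_i real_weight _ _ _ * _; set N := norm2 (submxcol bh j) => le_pen.
have N0 : 0 < N by rewrite norm2_gt0.
(* Expanding at [b'] rather than at [bh] bounds [loss b' - loss bh] from above by the score at [b'];
   the quadratic term is dropped by its sign. *)
have := loss_strongly_convex tau0 tau1 X y n b' (bh - b').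
rewrite subrKC => growth.
have quad0 : 0 <= Num.min tau (1 - tau) * \sum_(i < n) dot (X i) (bh - b') ^+ 2.
  rewrite mulr_ge0 ?le_min ?(ltW tau0) ?subr_ge0 ?(ltW tau1) //.
  by apply: sumr_ge0 => i _; exact: sqr_ge0.
have large := penalty_large; set M2 := M + _ in large.
have score_b' : norm2 (@score R tau _ X y n b') <= M2 * s.
  (* The competitor is as close to [beta0] as [bh] is, so moving the score from [beta0] to [b']
     costs at most [n * 2 * B ^+ 2 * (M + 1) / (kappa * s)], of order [s]. *)
  rewrite -(subrKC (@score R tau _ X y n beta0) (score X y n b')).
  rewrite (le_trans (norm2D _ _)) // /M2 mulrDl lerD //.
  rewrite -{1}(subrKC beta0 b').
  rewrite (le_trans (score_lipschitz tau0 tau1 _ _ _ _ _ _ design_bound)) //.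
  have := le_trans (norm2_zero_group_sub bh beta0 j b0j) penalized_rate.
  have nB : 0 <= n%:R * (2 * B ^+ 2) by rewrite mulr_ge0 // mulr_ge0 // sqr_ge0.
  rewrite -/b' => /(ler_wpM2l nB) /le_trans; apply.
  rewrite ns le_eqVlt; apply/orP; left; apply/eqP; field.
  by rewrite !gt_eqF.
have := dot_ge _ (bh - b') _ score_b'; rewrite norm2_sub_zero_group -/N => dge.
have := weight_null j b0j btj; set w := real_weight _ _ _ in le_pen *.
move=> w_ge; have : M2 < lam * s * w.
  by rewrite (lt_le_trans large) // ler_pM2l // mulr_gt0.
(* Scaled by [s * N], the gain in penalty would have to be at most [M2 * s * N], contradicting
   [large]. *)
apply/negP; rewrite -leNgt -(ler_pM2r (mulr_gt0 s0 N0)).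
move: le_pen; rewrite ns => le_pen.
have : s ^+ 2 * (lam * (w * N)) <= loss tau X y n b' - loss tau X y n bh.
  rewrite -ler_pdivlMl ?exprn_gt0 // -subr_ge0.
  by move: le_pen; rewrite -subr_ge0; congr (_ <= _); ring.
lra.
Qed.

Lemma active_selected : active bh = active beta0.
Proof.
apply/setP => j; rewrite !activeE; apply/idP/idP; last exact: active_kept.
by apply: contra => /eqP/null_dropped ->.
Qed.

End selection.

(** * Probability of a large score *)

Section independence.
Context {d : measure_display} {Omega : measurableType d} {R : realType}.
Context {P : probability Omega R}.
Local Open Scope ereal_scope.

(** Independence makes the law of [(U, V)] agree with the product of the marginal laws on
    rectangles, hence everywhere; Fubini then separates the two factors. *)
Lemma expectationM_independent (U V : {RV P >-> R}) (phi psi : R -> R) :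
  (forall A B, measurable A -> measurable B ->
    P ((U @^-1` A) `&` (V @^-1` B)) = P (U @^-1` A) * P (V @^-1` B)) ->
  measurable_fun setT phi -> measurable_fun setT psi ->
  P.-integrable setT (EFin \o (phi \o U)) ->
  P.-integrable setT (EFin \o (psi \o V)) ->
  P.-integrable setT (fun w => (phi (U w) * psi (V w))%:E) ->
  'E_P[fun w => (phi (U w) * psi (V w))%R] =
  'E_P[phi \o U] * 'E_P[psi \o V].
Proof.
move=> UV mphi mpsi iphi ipsi iphipsi.
pose T w := (U w, V w).
have mT : measurable_fun setT T by apply: measurable_fun_pair.
pose f (z : R * R) : \bar R := (phi z.1 * psi z.2)%:E.
have mf : measurable_fun [set: R * R] f.
  apply/measurable_EFinP; apply: measurable_funM.
    exact: (measurableT_comp mphi measurable_fst).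
  exact: (measurableT_comp mpsi measurable_snd).
pose joint := pushforward P T.
have prodE A : measurable A ->
    (distribution P U \x distribution P V)%E A = joint A.
  by move=> mA; exact: product_measure_unique.
have ijoint : joint.-integrable setT f by exact: integrable_pushforward.
have iprod : (distribution P U \x distribution P V).-integrable setT f.
  have /integrableP[_ fin] := ijoint; apply/integrableP; split => //.
  by rewrite (eq_measure_integral joint) // => A mA _; exact: prodE.
rewrite expectation.unlock -[LHS](@integral_pushforward _ _ _ _ _ T mT P setT f) //.
rewrite (eq_measure_integral (distribution P U \x distribution P V)); last first.
  by move=> A mA _; exact: esym (prodE A mA).
rewrite -integral12_prod_meas1 // /fubini_F.
have inner x : \int[distribution P V]_y f (x, y) =
    (phi x)%:E * \int[P]_w ((psi \o V) w)%:E.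
  rewrite /f /=; under eq_integral do rewrite EFinM.
  rewrite integralZl //; last first.
    by apply: integrable_pushforward => //; apply/measurable_EFinP.
  by rewrite integral_distribution //; apply/measurable_EFinP.
under eq_integral do rewrite inner.
rewrite -(fineK (integrable_fin_num measurableT ipsi)) integralZr //.
  by rewrite integral_distribution //; apply/measurable_EFinP.
by apply: integrable_pushforward => //; apply/measurable_EFinP.
Qed.

End independence.

(** * Chebyshev bound for weighted sums of uncorrelated variables *)

Section second_moment.
Context {d : measure_display} {Omega : measurableType d} {R : realType}.
Context {P : probability Omega R}.

Lemma mutually_independent_pair {eps : nat -> {RV P >-> R}} {i j : nat}
    (A B : set R) : mutually_independent eps -> i != j ->
  measurable A -> measurable B ->
  (P ((eps i @^-1` A) `&` (eps j @^-1` B)) =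
   P (eps i @^-1` A) * P (eps j @^-1` B))%E.
Proof.
move=> ind ij mA mB; have ji : (j == i) = false by rewrite eq_sym (negPf ij).
have := ind [fset i; j]%fset (fun k => if k == i then A else B).
rewrite big_fsetU1 ?inE // big_seq_fset1 eqxx ji => <-.
  congr (P _); apply/seteqP; split => w /=.
    move=> [Aw Bw] k /=; rewrite !inE.
    by move=> /orP[/eqP ->|/eqP ->]; rewrite ?eqxx ?ji.
  move=> h; split.
    by have := h i; rewrite /= !inE eqxx; apply.
  by have := h j; rewrite /= !inE eqxx orbT ji; apply.
by move=> k; case: ifP.
Qed.

Lemma measurable_g (tau : R) : measurable_fun setT (g tau).
Proof.
(* Positive and negative parts absorb the indicators. *)
rewrite (_ : g tau = fun e : R =>
  - 2 * (tau * Num.max e 0 + (1 - tau) * Num.min e 0)).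
  apply: measurable_funM => //; apply: measurable_funD.
    by apply: measurable_funM => //; exact: measurable_maxr.
  by apply: measurable_funM => //; exact: measurable_minr.
by apply/funext => e; rewrite /g; case: ltrP => e0 /=; ring.
Qed.

Context {xi : nat -> Omega -> R} {K : R}.
Hypothesis xi_meas : forall i, measurable_fun setT (xi i).
Hypothesis xi_sqr : forall i, (\int[P]_w (xi i w ^+ 2)%:E <= K%:E)%E.
Hypothesis xi_uncorrelated :
  forall i j, i != j -> ('E_P[fun w => (xi i w * xi j w)%R] = 0)%E.

Lemma integrable_sqr i : P.-integrable setT (fun w => (xi i w ^+ 2)%:E).
Proof.
apply/integrableP; split; first by apply/measurable_EFinP; exact: measurable_funX.
apply: (@le_lt_trans _ _ K%:E); last exact: ltry.
apply: le_trans (xi_sqr i).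
by under eq_integral do rewrite gee0_abs ?lee_fin ?sqr_ge0 //.
Qed.

Lemma integrable_mul i j : P.-integrable setT (fun w => (xi i w * xi j w)%:E).
Proof.
apply: (@le_integrable _ _ _ _ _ measurableT _
  (fun w => (xi i w ^+ 2)%:E + (xi j w ^+ 2)%:E)%E).
- by apply/measurable_EFinP; exact: measurable_funM.
- move=> w _; rewrite -EFinD !abse_EFin lee_fin [leRHS]ger0_norm; last first.
    by rewrite addr_ge0 ?sqr_ge0.
  have := sqr_ge0 (xi i w - xi j w); have := sqr_ge0 (xi i w + xi j w).
  by rewrite sqrrD sqrrB ler_norml; move=> h1 h2; apply/andP; split; lra.
- by apply: integrableD => //; exact: integrable_sqr.
Qed.

Lemma dot_weighted_sum {r : nat} (x : nat -> 'cV[R]_r) (n : nat) (c : nat -> R) :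
  dot (\sum_(i < n) c i *: x i) (\sum_(i < n) c i *: x i) =
  \sum_(i < n) \sum_(j < n) dot (x i) (x j) * (c i * c j).
Proof.
rewrite dot_suml; apply: eq_bigr => i _.
rewrite dotC dot_suml; apply: eq_bigr => j _.
by rewrite dotZl dotZr dotC; ring.
Qed.

(** After expansion of the square the cross terms integrate to 0, and each of the [n] diagonal terms
    is at most [K * B ^+ 2]. *)
Lemma second_moment_le {r : nat} (x : nat -> 'cV[R]_r) (B : R) (n : nat) :
  (forall i, norm2 (x i) <= B) ->
  (\int[P]_w (dot (\sum_(i < n) xi i w *: x i)
                  (\sum_(i < n) xi i w *: x i))%:E <= (n%:R * (K * B ^+ 2))%:E)%E.
Proof.
move=> xB.
have E w : (dot (\sum_(i < n) xi i w *: x i) (\sum_(i < n) xi i w *: x i))%:E =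
    (\sum_(i < n) \sum_(j < n) (dot (x i) (x j))%:E * (xi i w * xi j w)%:E)%E.
  rewrite (dot_weighted_sum x n (xi^~ w)) -sumEFin; apply: eq_bigr => i _.
  by rewrite -sumEFin; apply: eq_bigr => j _; rewrite -EFinM.
under eq_integral do rewrite E.
rewrite integral_sum //; last first.
  move=> i; apply: integrable_sum => // j _.
  by apply: integrableZl => //; exact: integrable_mul.
apply: (@le_trans _ _ (\sum_(i < n) (K * B ^+ 2)%:E)%E); last first.
  by rewrite sumEFin sumr_const card_ord -[_ *+ n]mulr_natl.
apply: lee_sum => i _; rewrite integral_sum //; last first.
  by move=> j; apply: integrableZl => //; exact: integrable_mul.
rewrite (bigD1 i) //= big1 => [|j ji]; last first.
  rewrite integralZl //; last exact: integrable_mul.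
  have := xi_uncorrelated i j; rewrite eq_sym ji expectation.unlock => -> //.
  by rewrite mule0.
rewrite adde0 integralZl //; last exact: integrable_mul.
rewrite mulrC EFinM; apply: lee_pmul.
- by rewrite lee_fin dotvv_ge0.
- by apply: integral_ge0 => w _; rewrite lee_fin -expr2 sqr_ge0.
- by rewrite lee_fin -norm2_le // (le_trans (norm2_ge0 (x i))).
- by under eq_integral do rewrite -expr2.
Qed.

Lemma measurable_weighted_sum {r : nat} (x : nat -> 'cV[R]_r) (n : nat) :
  measurable_fun setT (fun w =>
    dot (\sum_(i < n) xi i w *: x i) (\sum_(i < n) xi i w *: x i)).
Proof.
under eq_fun do rewrite (dot_weighted_sum x n (xi^~ _)).
apply: measurable_sum => i; apply: measurable_sum => j.
by apply: measurable_funM => //; exact: measurable_funM.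
Qed.

Lemma measurable_tail {r : nat} (x : nat -> 'cV[R]_r) (n : nat) c :
  measurable [set w | c < norm2 (\sum_(i < n) xi i w *: x i)].
Proof.
pose F w := norm2 (\sum_(i < n) xi i w *: x i).
have mF : measurable_fun setT F.
  rewrite (_ : F = Num.sqrt \o (fun w =>
    dot (\sum_(i < n) xi i w *: x i) (\sum_(i < n) xi i w *: x i))).
    apply: measurableT_comp (measurable_weighted_sum x n).
    by apply: continuous_measurable_fun; exact: sqrt_continuous.
  by apply/funext => w; rewrite /= /F -norm2_sqr sqrtr_sqr ger0_norm ?norm2_ge0.
by rewrite -[X in measurable X]setTI; apply: measurable_fun_ltr.
Qed.

(** Markov's inequality for the squared norm at level [M ^+ 2 * n%:R]; the factor [n] cancels
    against the second moment. *)
Lemma tail_bound {r : nat} (x : nat -> 'cV[R]_r) (B M : R) (n : nat) :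
  0 < M -> (0 < n)%N -> (forall i, norm2 (x i) <= B) ->
  (P [set w | (M * Num.sqrt n%:R < norm2 (\sum_(i < n) xi i w *: x i))%R] <=
   (K * B ^+ 2 / M ^+ 2)%:E)%E.
Proof.
move=> M0 n0 xB; have n0' : 0 < n%:R :> R by rewrite ltr0n.
set T := [set w | _]; have mT : measurable T by exact: measurable_tail.
pose F w := dot (\sum_(i < n) xi i w *: x i) (\sum_(i < n) xi i w *: x i).
have mF : measurable_fun setT F by exact: measurable_weighted_sum.
have c0 : 0 < M ^+ 2 * n%:R by rewrite mulr_gt0 // exprn_gt0.
have := @le_integral_comp_abse _ _ _ P setT measurableT (EFin \o F)
  (M ^+ 2 * n%:R) id (@measurable_id _ _ setT) (fun _ h => h)
  (fun _ _ _ _ h => h) _ c0.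
have mEF : measurable_fun setT (EFin \o F) by apply/measurable_EFinP.
move=> /(_ mEF) markov_ineq.
have : ((M ^+ 2 * n%:R)%:E * P T <= (n%:R * (K * B ^+ 2))%:E)%E.
  apply: (le_trans _ (second_moment_le x B n xB)).
  apply: (@le_trans _ _ (\int[P]_w `|(EFin \o F) w|)%E); last first.
    by under eq_integral do rewrite gee0_abs ?lee_fin ?dotvv_ge0 //.
  apply: le_trans markov_ineq; apply: lee_pmul => //; first by rewrite lee_fin ltW.
  apply: le_measure; rewrite ?inE //.
    rewrite [X in measurable X](_ : _ = setT `&`
      (fun w => M ^+ 2 * n%:R <= `|F w|) @^-1` [set true]) //.
    by apply: measurable_fun_ler => //; exact: measurableT_comp.
  move=> w /= Tw; split => //=; rewrite lee_fin ger0_norm ?dotvv_ge0 //.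
  rewrite /F -norm2_sqr; have -> : M ^+ 2 * n%:R = (M * Num.sqrt n%:R) ^+ 2.
    by rewrite exprMn sqr_sqrtr // ltW.
  by rewrite ler_pXn2r ?nnegrE ?norm2_ge0 ?mulr_ge0 ?sqrtr_ge0 ?(ltW M0) // ltW.
rewrite -lee_pdivlMl // -EFinM => /le_trans; apply; rewrite lee_fin.
rewrite le_eqVlt; apply/orP; left; apply/eqP; field.
by rewrite !gt_eqF.
Qed.

End second_moment.

(** * Moments of the errors transformed by [g] *)

Section error_moments.
Context {d : measure_display} {Omega : measurableType d} {R : realType}.
Context {P : probability Omega R} {tau : R} {eps : nat -> {RV P >-> R}}.
Hypotheses (tau0 : 0 < tau) (tau1 : tau < 1).
Hypothesis errors : error_assumption tau eps.

Lemma measurable_g_error i : measurable_fun setT (fun w => g tau (eps i w)).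
Proof.
exact: (measurableT_comp (measurable_g tau) (measurable_funP (eps i))).
Qed.

(** The square of [g tau e] is at most [4 * e ^+ 2], hence at most [4 * (1 + e ^+ 4)], which is
    integrable. Identical distribution lets the moment at index 0 serve for all indices. *)
Lemma g_error_sqr_bounded :
  exists2 K : R, 0 <= K &
    forall i, (\int[P]_w (g tau (eps i w) ^+ 2)%:E <= K%:E)%E.
Proof.
have [_ same _ _ fourth] := errors.
have msqr : measurable_fun [set: R] (fun e => (g tau e ^+ 2)%:E).
  by apply/measurable_EFinP; apply: measurable_funX; exact: measurable_g.
have sqr_same i :
    (\int[P]_w (g tau (eps i w) ^+ 2)%:E = \int[P]_w (g tau (eps 0 w) ^+ 2)%:E)%E.
  rewrite -(ge0_integral_distribution (eps i) msqr); last first.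
    by move=> y; rewrite lee_fin sqr_ge0.
  rewrite -(ge0_integral_distribution (eps 0) msqr); last first.
    by move=> y; rewrite lee_fin sqr_ge0.
  by apply: eq_measure_integral => A mA _; exact: same.
have int4 : P.-integrable setT (fun w => (eps 0 w ^+ 4)%:E).
  apply/integrableP; split.
    by apply/measurable_EFinP; exact: measurable_funX.
  have := fourth 0; rewrite expectation.unlock; apply: le_lt_trans.
  by under eq_integral do rewrite gee0_abs ?lee_fin ?exprn_even_ge0 //.
have int2 : P.-integrable setT (fun w => (g tau (eps 0 w) ^+ 2)%:E).
  apply: (@le_integrable _ _ _ _ _ measurableT _
    (fun w => (4%:E * (cst 1 w + (eps 0 w ^+ 4)%:E))%E)).
  - exact: (measurableT_comp msqr (measurable_funP (eps 0))).
  - move=> w _; rewrite /cst -EFinD -EFinM !abse_EFin lee_fin.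
    rewrite !ger0_norm ?sqr_ge0 //; last first.
      by rewrite mulr_ge0 // addr_ge0 // exprn_even_ge0.
    have gle : g tau (eps 0 w) ^+ 2 <= (2 * `|eps 0 w|) ^+ 2.
      rewrite -[leLHS]real_normK ?num_real // ler_pXn2r ?nnegrE ?mulr_ge0 //.
      exact: g_norm_le.
    apply: (le_trans gle); rewrite exprMn real_normK ?num_real //.
    have := sqr_ge0 (eps 0 w ^+ 2 - 1); rewrite sqrrB -exprM.
    have := sqr_ge0 (eps 0 w); lra.
  - apply: integrableZl => //; apply: integrableD => //.
    exact: finite_measure_integrable_cst.
exists (fine (\int[P]_w (g tau (eps 0 w) ^+ 2)%:E)).
  by apply: fine_ge0; apply: integral_ge0 => w _; rewrite lee_fin sqr_ge0.
by move=> i; rewrite sqr_same fineK // (integrable_fin_num measurableT int2).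
Qed.

Lemma g_error_uncorrelated i j : i != j ->
  ('E_P[fun w => (g tau (eps i w) * g tau (eps j w))%R] = 0)%E.
Proof.
move=> ij; have [ind _ mean0 _ _] := errors.
have [K _ sqrK] := g_error_sqr_bounded.
have int1 k : P.-integrable setT (EFin \o (g tau \o eps k)).
  apply: (@le_integrable _ _ _ _ _ measurableT _
    (fun w => (cst 1 w + (g tau (eps k w) ^+ 2)%:E)%E)).
  - by apply/measurable_EFinP; exact: measurable_g_error.
  - move=> w _; rewrite /cst -EFinD !abse_EFin lee_fin /=.
    rewrite [leRHS]ger0_norm ?addr_ge0 ?sqr_ge0 //.
    move: (g tau (eps k w)) => x; rewrite -(real_normK (num_real x)).
    have := normr_ge0 x; have := sqr_ge0 (`|x| - 1); rewrite sqrrB; lra.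
  - apply: integrableD => //; first exact: finite_measure_integrable_cst.
    exact: (integrable_sqr measurable_g_error sqrK).
rewrite (expectationM_independent (eps i) (eps j) (g tau) (g tau)) //.
- by rewrite (mean0 j) mule0.
- by move=> A B mA mB; exact: mutually_independent_pair.
- exact: measurable_g.
- exact: measurable_g.
- exact: (integrable_mul measurable_g_error sqrK).
Qed.

Lemma score_error_tail {r : nat} (X : nat -> 'cV[R]_r) (B e : R) :
  0 < e -> (forall i, norm2 (X i) <= B) ->
  exists2 M : R, 0 < M & forall n, (0 < n)%N ->
  (P [set w | (M * Num.sqrt n%:R <
       norm2 (\sum_(i < n) g tau (eps i w) *: X i))%R] <= e%:E)%E.
Proof.
move=> e0 XB; have [K K0 sqrK] := g_error_sqr_bounded.
have KB : 0 <= K * B ^+ 2 / e.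
  by rewrite divr_ge0 ?(ltW e0) // mulr_ge0 // sqr_ge0.
(* This [M] makes the Chebyshev bound at most [e], uniformly in [n]; adding 1 keeps it positive when
   [K * B ^+ 2] is 0. *)
have M0 : 0 < Num.sqrt (K * B ^+ 2 / e) + 1 by rewrite ltr_wpDl // sqrtr_ge0.
exists (Num.sqrt (K * B ^+ 2 / e) + 1) => // n n0.
have := tail_bound measurable_g_error sqrK g_error_uncorrelated X B _ n M0 n0 XB.
move=> /le_trans; apply; rewrite lee_fin ler_pdivrMr ?exprn_gt0 //.
rewrite [e * _]mulrC -ler_pdivrMr // -[leLHS](sqr_sqrtr KB).
by rewrite ler_pXn2r ?nnegrE ?sqrtr_ge0 ?(ltW M0) // lerDl.
Qed.

End error_moments.

(** * Consistency *)

(** A finite intersection, over the groups, of conditions on whether a measurable squared norm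
    vanishes. *)
Lemma measurable_active {d : measure_display} {Omega : measurableType d}
    {R : realType} {p : nat} {dg : 'I_p -> nat}
    (V : Omega -> 'cV[R]_(\sum_(j < p) dg j)) (S : {set 'I_p}) :
  random_vector V -> measurable [set w | active (V w) = S].
Proof.
move=> mV; rewrite (_ : [set w | _] =
  \bigcap_(j in [set: 'I_p]) [set w | (submxcol (V w) j != 0) = (j \in S)]).
  apply: fin_bigcap_measurable => // j _.
  pose F w := dot (submxcol (V w) j) (submxcol (V w) j).
  have mF : measurable_fun setT F.
    rewrite (_ : F = fun w => \sum_i submxcol (V w) j i 0 ^+ 2); last first.
      by apply/funext => w; rewrite /F dotvv.
    apply: measurable_sum => i; apply: measurable_funX.
    by under eq_fun do rewrite mxE; exact: mV.
  have mF0 : measurable_fun setT (fun w => F w == 0) by exact: measurable_fun_eqr.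
  rewrite [X in measurable X](_ : _ =
    setT `&` (fun w => F w == 0) @^-1` [set (j \notin S)]); first exact: mF0.
  apply/seteqP; split => w /=; rewrite /F dotvv_eq0.
    by move=> <-; rewrite negbK.
  by move=> [_ ->]; rewrite negbK.
apply/seteqP; split => w /=.
  by move=> <- j _ /=; rewrite activeE.
by move=> h; apply/setP => j; rewrite activeE h.
Qed.

(** * Rates and powers of [n] *)

Section asymptotics.
Context {R : realType}.

Lemma near_sqrt_ge (c : R) : \forall n \near \oo, c <= Num.sqrt n%:R.
Proof.
near=> n; rewrite (le_trans (ler_norm c)) // -sqrtr_sqr ler_wsqrtr //.
by near: n; exact: nbhs_infty_ger.
Unshelve. all: by end_near. Qed.

Lemma near_rate_le (c a : R) : 0 <= c -> 0 < a ->
  \forall n \near \oo, c / Num.sqrt n%:R <= a.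
Proof.
move=> c0 a0; near=> n.
have n0 : 0 < Num.sqrt n%:R :> R.
  by rewrite (@lt_le_trans _ _ 1) //; near: n; exact: near_sqrt_ge.
rewrite ler_pdivrMr // mulrC -ler_pdivrMr //.
by near: n; exact: near_sqrt_ge.
Unshelve. all: by end_near. Qed.

Lemma powR_half_succ (gamma : R) n : (0 < n)%N ->
  n%:R `^ ((gamma + 1) / 2) = Num.sqrt n%:R `^ gamma * Num.sqrt n%:R :> R.
Proof.
move=> n0; rewrite mulrC powRrM powR12_sqrt ?ler0n // powRD ?powRr1 ?sqrtr_ge0 //.
by apply/implyP => _; rewrite gt_eqF // sqrtr_gt0 ltr0n.
Qed.

Lemma powR_rate (gamma c s : R) : 0 <= c -> 0 < s ->
  ((c / s) `^ gamma)^-1 = s `^ gamma / c `^ gamma.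
Proof.
move=> c0 s0; rewrite powRM ?invr_ge0 ?(ltW s0) //.
by rewrite -(powR_inv1 (ltW s0)) -powRrM mulN1r powRN invfM invrK mulrC.
Qed.

End asymptotics.

Theorem theorem3p2
  (R : realType) (d : measure_display) (Omega : measurableType d)
  (P : probability Omega R)
  (p : nat) (dg : 'I_p -> nat) (p0 : nat)
  (beta0 : 'cV[R]_(\sum_(j < p) dg j))
  (X : nat -> 'cV[R]_(\sum_(j < p) dg j))
  (eps : nat -> {RV P >-> R})
  (Y : nat -> Omega -> R)
  (tau gamma : R) (lam : nat -> R)
  (betat betah : nat -> Omega -> 'cV[R]_(\sum_(j < p) dg j))
  (hp0 : (p0 <= p)%N)
  (hbeta0_active : forall j : 'I_p, (j < p0)%N -> norm2 (submxcol beta0 j) != 0)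
  (hbeta0_null : forall j : 'I_p, (p0 <= j)%N -> norm2 (submxcol beta0 j) = 0)
  (hY : forall i w, Y i w = dot (X i) beta0 + eps i w)
  (htau0 : 0 < tau) (htau1 : tau < 1) (hgamma : 0 < gamma)
  (hlam : forall n, (0 < n)%N -> 0 < lam n)
  (hbetat_rv : forall n, random_vector (betat n))
  (hbetah_rv : forall n, random_vector (betah n))
  (hbetat : forall n w, (0 < n)%N ->
    is_argmin (loss tau X (Y^~ w) n) (betat n w))
  (hbetah : forall n w, (0 < n)%N ->
    is_argmin (penalized_loss tau gamma (lam n) X (Y^~ w) n (betat n w))
      (betah n w))
  (hA1 : error_assumption tau eps)
  (hA2 : design_bounded X)
  (hA3 : gram_eigenvalues_bounded X)
  (hlam0 : lam n @[n --> \oo] --> (0 : R))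
  (hlam_sqrt : n%:R `^ (1 / 2) * lam n @[n --> \oo] --> (0 : R))
  (hlam_gamma : n%:R `^ ((gamma + 1) / 2) * lam n @[n --> \oo] --> +oo) :
  P [set w | active (betah n w) = active beta0] @[n --> \oo] --> 1%E.
Proof.
have [B XB] : exists B, forall i, norm2 (X i) <= B.
  have [C0 _ XC0] := hA2.
  exists (Num.sqrt (\sum_(j < p) dg j)%:R * C0) => i.
  (* Observation [i] first enters the maximum at sample size [i.+1]. *)
  apply: norm2_le_mx_norm; apply: le_trans (XC0 i.+1).
  exact: (le_bigmax _ (fun k : 'I_i.+1 => mx_norm (X k)) ord_max).
have [m0 [M0 [m0_gt0 _ nearX]]] := hA3.
have [a a0 beta0_ge] : exists2 a, 0 < a &
    forall j, submxcol beta0 j != 0 -> a <= norm2 (submxcol beta0 j).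
  (* The default value 1 keeps the minimum positive even if no group is active. *)
  exists (\big[Num.min/1]_(j | submxcol beta0 j != 0) norm2 (submxcol beta0 j)).
    by apply: lt_bigmin => // j; rewrite norm2_gt0.
  by move=> j bj; exact: bigmin_le_cond.
pose A n := [set w | active (betah n w) = active beta0].
have mA n : measurable (A n) by exact: measurable_active.
apply/fine_cvgP; split.
  by apply: nearW => n; rewrite fin_num_measure //; exact: mA.
apply/cvgrPdist_le => e e0.
(* [M] depends on [e] only, so the conditions of the deterministic part can be met for all large [n]
   with [M] fixed. *)
have [M M_gt0 tail] := score_error_tail htau0 htau1 hA1 X B e e0 XB.
have sX n w : score (tau := tau) X (Y^~ w) n beta0 =
    \sum_(i < n) g tau (eps i w) *: X i.
  by apply: eq_bigr => i _; rewrite hY addrC addKr.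
pose kappa := Num.min tau (1 - tau) * m0.
have kappa0 : 0 < kappa by rewrite mulr_gt0 // lt_min htau0 subr_gt0.
pose pOmega := p%:R * ((a / 2) `^ gamma)^-1.
have pOmega0 : 0 <= pOmega by rewrite mulr_ge0 // invr_ge0 powR_ge0.
pose M2 := M + 2 * B ^+ 2 * ((M + 1) / kappa).
have Mk0 : 0 < M / kappa by rewrite divr_gt0.
have M1k0 : 0 <= (M + 1) / kappa by rewrite divr_ge0 ?addr_ge0 // ltW.
have Mkg0 : 0 < (M / kappa) `^ gamma by rewrite powR_gt0.
near=> n.
have n0 : (0 < n)%N by near: n; exists 1%N.
have s0 : 0 < Num.sqrt n%:R :> R by rewrite sqrtr_gt0 ltr0n.
have sqrtE : n%:R `^ (1 / 2) = Num.sqrt n%:R :> R by rewrite div1r powR12_sqrt.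
have curvature (h : 'cV[R]_(\sum_(j < p) dg j)) :
    n%:R * m0 * dot h h <= \sum_(i < n) dot (X i) h ^+ 2.
  apply: le_trans (delta_min_gram X n h n0).
  rewrite ler_wpM2r ?dotvv_ge0 // ler_wpM2l ?ler0n //.
  suff [] : m0 <= delta_min (gram X n) /\
    delta_min (gram X n) <= delta_max (gram X n) /\
    delta_max (gram X n) <= M0 by [].
  by near: n.
have close : M / (kappa * Num.sqrt n%:R) <= a / 2.
  rewrite invfM mulrA; near: n; apply: near_rate_le; first exact: ltW.
  by rewrite divr_gt0.
have close' : (M + 1) / (kappa * Num.sqrt n%:R) < a.
  apply: (@le_lt_trans _ _ (a / 2)); last first.
    by rewrite ltr_pdivrMr // mulr_natr mulr2n ltrDl.
  rewrite invfM mulrA; near: n; apply: near_rate_le => //.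
  by rewrite divr_gt0.
have small : lam n * Num.sqrt n%:R * pOmega <= 1.
  (* The bound [(pOmega + 1)^-1] avoids dividing by [pOmega], which is 0 when [p = 0]. *)
  apply: (@le_trans _ _ ((pOmega + 1)^-1 * pOmega)); last first.
    by rewrite mulrC ler_pdivrMr ?ltr_wpDl // mul1r lerDl.
  apply: ler_wpM2r => //; rewrite mulrC -sqrtE (le_trans (ler_norm _)) //.
  rewrite -normrN -sub0r; near: n; move/cvgrPdist_le: hlam_sqrt; apply.
  by rewrite invr_gt0 ltr_wpDl.
have large : M2 <
    lam n * Num.sqrt n%:R * ((M / (kappa * Num.sqrt n%:R)) `^ gamma)^-1.
  (* The claim becomes [M2 * (M / kappa)]^ gamma < n%:R [^ ((gamma + 1) / 2) * lam n], with a
     constant on the left, so the divergence assumption on [lam] applies. *)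
  rewrite [M / _](_ : _ = M / kappa / Num.sqrt n%:R); last by rewrite invfM mulrA.
  rewrite powR_rate ?(ltW Mk0) // mulrA ltr_pdivlMr //.
  rewrite -mulrA [ltRHS]mulrC [Num.sqrt _ * _]mulrC -powR_half_succ //.
  by near: n; move/cvgryPgt: hlam_gamma; apply.
(* Contrapositive of [active_selected]: wrong selection forces a large score, an event of
   probability at most [e]. *)
have sub w : (~` A n) w ->
    M * Num.sqrt n%:R < norm2 (\sum_(i < n) g tau (eps i w) *: X i).
  move=> nA; rewrite ltNge; apply/negP => le_score; apply: nA.
  have := @active_selected R p dg tau gamma (lam n) X (Y^~ w) n beta0
    (betat n w) (betah n w) m0 B M a.
  by apply => //; [exact: hlam | rewrite sX | exact: hbetat | exact: hbetah].
have PA : (P (~` A n) <= e%:E)%E.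
  apply: le_trans (tail n n0); apply: le_measure; rewrite ?inE //.
    exact: measurableC.
  exact: (measurable_tail (measurable_g_error (eps := eps))).
rewrite /= -/(A n) ger0_norm; last first.
  by rewrite subr_ge0 -lee_fin fineK ?fin_num_measure // probability_le1.
rewrite -lee_fin EFinB fineK ?fin_num_measure //.
by rewrite -probability_setC.
Unshelve. all: by end_near. Qed.
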